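(* Let $S$ be an ordered semigroup. Then $S$ is a nil extension of a left group like ordered semigroup if and only if both of the following conditions hold: (1) for all $a, b \in S$ there exists $n \in \mathbb{N}$ such that $a^{n} \in (a^{n}Sa^{n}b]$; and (2) for all $a \in S$ and $b \in Reg_\leq(S)$, if $a \leq ba$ then there exists $x \in S$ such that $a \leq axb$.
   Context: $\mathbb{N}$ is the set of natural numbers (positive integers). An ordered semigroup $(S,\cdot,\leq)$ is a (nonempty) partially ordered set $(S,\leq)$ together with a semigroup structure $(S,\cdot)$ such that for all $a,b,x \in S$, $a \leq b$ implies $xa \leq xb$ and $ax \leq bx$. For $H \subseteq S$, $(H] = \{t \in S : t \leq h \text{ for some } h \in H\}$. For elements $u,v \in S$, $uSv = \{usv : s \in S\}$. A nonempty subset $I \subseteq S$ is an ideal of $S$ if $SI \subseteq I$, $IS \subseteq I$ and $(I] = I$. $S$ is a nil extension of an ideal $I$ if the Rees factor ordered semigroup $S/I$ is nil (every element has some power equal to zero); equivalently, for every $a \in S$ there exists $m \in \mathbb{N}$ with $a^m \in I$. ''$S$ is a nil extension of a left group like ordered semigroup'' means that there is an ideal $K$ of $S$ such that $S$ is a nil extension of $K$ and $K$, with the restricted operation and order, is a left group like ordered semigroup. $Reg_\leq(S) = \{a \in S : a \in (aSa]\} = \{a \in S : a \leq axa \text{ for some } x \in S\}$ is the set of regular elements of $S$. $S$ is regular if $S = Reg_\leq(S)$. An ordered semigroup $K$ is left group like if it is regular and for all $a, b \in K$ there is $x \in K$ such that $a \leq xb$. *)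

(* Defs.v *)
From HB Require Import structures.
From mathcomp Require Import all_boot all_order.
From mathcomp Require Import boolp classical_sets.

Set Implicit Arguments.
Unset Strict Implicit.
Unset Printing Implicit Defensive.

Local Open Scope order_scope.
Local Open Scope classical_set_scope.
Local Open Scope group_scope.

HB.mixin Record isOrderedSemigroup (d : Order.disp_t) S
    of Semigroup S & Order.POrder d S := {
  osg_nonempty : [set: S] !=set0 ;
  le_mulgl : forall x a b : S, a <= b -> x * a <= x * b ;
  le_mulgr : forall x a b : S, a <= b -> a * x <= b * x
}.

#[short(type="orderedSemigroupType")]
HB.structure Definition OrderedSemigroup (d : Order.disp_t) :=
  { S of Semigroup S & Order.POrder d S & isOrderedSemigroup d S }.

(* A semigroup need not have a unit, so only positive exponents are meaningful:
   spow a n is a * (a * .. (a * a)) with n factors for n > 0, and spow a 0 is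
   the junk value a. *)
Definition spow (S : semigroupType) (a : S) (n : nat) : S :=
  iterop n (fun x y : S => x * y) a a.

Definition sandwich (S : semigroupType) (u v : S) : set S :=
  [set u * s * v | s in [set: S]].

(* (H] is the library's [down H]. *)
Definition Reg (d : Order.disp_t) (S : orderedSemigroupType d) : set S :=
  [set a | down (sandwich a a) a].
Arguments Reg {d} S.

Definition regular (d : Order.disp_t) (S : orderedSemigroupType d) : Prop :=
  [set: S] = Reg S.
Arguments regular {d} S.

Definition left_group_like (d : Order.disp_t) (K : orderedSemigroupType d)
    : Prop :=
  regular K /\ forall a b : K, exists x : K, a <= x * b.
Arguments left_group_like {d} K.

Record ideal (d : Order.disp_t) (S : orderedSemigroupType d) := Ideal {
  ideal_set :> set S ;
  ideal_nonempty : ideal_set !=set0 ;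
  ideal_mull : [set s * i | s in [set: S] & i in ideal_set] `<=` ideal_set ;
  ideal_mulr : [set i * s | i in ideal_set & s in [set: S]] `<=` ideal_set ;
  ideal_down : down ideal_set = ideal_set
}.
Arguments ideal {d} S.

Definition ideal_type (d : Order.disp_t) (S : orderedSemigroupType d)
    (I : ideal S) : Type :=
  {x : S | x \in (I : set S)}.

Section IdealOrderedSemigroup.
Variables (d : Order.disp_t) (S : orderedSemigroupType d) (I : ideal S).

HB.instance Definition _ := SubChoice.copy (ideal_type I)
  {x : S | x \in (I : set S)}.

Lemma ideal_mulg_closed : mulg_closed (fun x : S => x \in (I : set S)).
Proof.
move=> x y _ /set_mem Iy; apply/mem_set; apply: ideal_mull.
by exists x => //; exists y.
Qed.

HB.instance Definition _ := SubChoice_isSubSemigroup.Build S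
  (fun x : S => x \in (I : set S)) (ideal_type I) ideal_mulg_closed.

HB.instance Definition _ := Order.SubChoice_isSubPOrder.Build d S
  (fun x : S => x \in (I : set S)) d (ideal_type I).

Lemma ideal_type_nonempty : [set: ideal_type I] !=set0.
Proof.
by have [x Ix] := ideal_nonempty I; exists (exist _ x (mem_set Ix)).
Qed.

Lemma ideal_le_mulgl (x a b : ideal_type I) : a <= b -> x * a <= x * b.
Proof. by rewrite -!Order.le_val !valM; apply: le_mulgl. Qed.

Lemma ideal_le_mulgr (x a b : ideal_type I) : a <= b -> a * x <= b * x.
Proof. by rewrite -!Order.le_val !valM; apply: le_mulgr. Qed.

HB.instance Definition _ := isOrderedSemigroup.Build d (ideal_type I)
  ideal_type_nonempty ideal_le_mulgl ideal_le_mulgr.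

End IdealOrderedSemigroup.

(* The zero of the Rees factor S/I is the class I, so the power of (the class
   of) a vanishes in S/I exactly when it lies in I. *)
Definition nil_extension (d : Order.disp_t) (S : orderedSemigroupType d)
    (I : ideal S) : Prop :=
  forall a : S, exists2 m : nat, (0 < m)%N & spow a m \in (I : set S).

Definition nil_extension_of_left_group_like (d : Order.disp_t)
    (S : orderedSemigroupType d) : Prop :=
  exists K : ideal S, nil_extension K /\ left_group_like (ideal_type K).
Arguments nil_extension_of_left_group_like {d} S.

(* Main.v *)
Require Import Defs.
From mathcomp Require Import all_boot all_order.
From mathcomp Require Import boolp classical_sets.

Import Order.TTheory.

Local Open Scope order_scope.
Local Open Scope classical_set_scope.
Local Open Scope group_scope.

(** Write Sb for the set of left multiples of b, and call a left-minimal when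
    a lies in (Sb] for every b.

    If S is a nil extension of a left group like ideal K, some power p of a
    is in K, and so is pb. Elements of K satisfy p <= pxp and p <= y(pb), so
    p <= p(xy)(pb), which is (1). A regular b <= bzb satisfies b <= (bz)^m b, and (bz)^m is in K
    for some m, so all regular elements are in K. In (2) this forces
    a <= ba into K, and a <= axa together with a <= yb gives a <= a(xy)b.

    Conversely, the kernel is K = Reg(S), and the point is that under (1) and
    (2) regular and left-minimal elements coincide. By (1) every element has a
    regular power ([regular_power]). If a <= axa then e = xa satisfies
    e <= ee, so e lies below all its powers, one of which is in (Sb] by (1);
    hence a <= ae is left-minimal ([Reg_le_mull]). If a is left-minimal then
    a <= za for some z, so a <= ba for a regular power b of z, and (2) gives
    a <= axb; as b is left-minimal, b <= ya, and a <= a(xy)a is regular. Only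
    a <= za and the regularity of b enter here ([regular_of_le_mull]), so for
    regular a and any c, multiplying a <= ya by c makes ac regular too. Left-minimality is visibly inherited by left
    multiples and smaller elements, so Reg(S) is an ideal, and regular inner
    elements can be chosen inside it ([Reg_ideal_left_group_like]). *)

Section OrderedSemigroupTheory.
Context {d : Order.disp_t} {S : orderedSemigroupType d}.
Implicit Types a b c e p x y z : S.

Lemma RegP a : a \in Reg S <-> exists x, a <= a * x * a.
Proof.
rewrite in_setE; split=> [[_ [[x _ <-] ax]]|[x ax]]; first by exists x.
by exists (a * x * a); split=> //; exists x.
Qed.

Lemma spowS a n : (0 < n)%N -> spow a n.+1 = a * spow a n.
Proof. by case: n. Qed.

Lemma le_spow_mull z a n : (0 < n)%N -> a <= z * a -> a <= spow z n * a.
Proof.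
move=> n0 za; elim: n n0 => // -[//|n] IHn _.
rewrite spowS // -mulgA; apply: (le_trans za).
exact/le_mulgl/IHn.
Qed.

Lemma le_spow_idem e n : (0 < n)%N -> e <= e * e -> e <= spow e n.
Proof.
move=> n0 ee; elim: n n0 => // -[//|n] IHn _.
rewrite spowS //; apply: (le_trans ee).
exact/le_mulgl/IHn.
Qed.

(** Substituting the bound for p into its own right-hand side pushes one more
    copy of a to the right while keeping the shape p t p. *)
Lemma le_mul_spow p s a n : (0 < n)%N -> p <= p * s * (p * a) ->
  exists t, p <= p * t * (p * spow a n).
Proof.
move=> n0 psa; elim: n n0 => // -[_ _|n IHn _]; first by exists s.
have [t pt] := IHn isT; exists (t * p * s); rewrite spowS //.
apply: (le_trans pt).
have := le_mulgr (spow a n.+1) _ _ (le_mulgl (p * t) _ _ psa).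
by rewrite !mulgA.
Qed.

Lemma ideal_le (K : ideal S) a b : a <= b -> ideal_set K b -> ideal_set K a.
Proof. by move=> ab Kb; rewrite -(ideal_down K); exists b. Qed.

Lemma ideal_mulgl (K : ideal S) a b : ideal_set K b -> ideal_set K (a * b).
Proof. by move=> Kb; apply: ideal_mull; exists a => //; exists b. Qed.

Lemma ideal_mulgr (K : ideal S) a b : ideal_set K a -> ideal_set K (a * b).
Proof. by move=> Ka; apply: ideal_mulr; exists a => //; exists b. Qed.

Section NilExtension.
Variable K : ideal S.

(** Transfers the property from the subtype carried by K to elements of S, so
    that all computations take place in S. *)
Lemma left_group_like_idealP : left_group_like (ideal_type K) <->
  (forall a, ideal_set K a -> exists2 x, ideal_set K x & a <= a * x * a) /\
  (forall a b, ideal_set K a -> ideal_set K b ->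
     exists2 x, ideal_set K x & a <= x * b).
Proof.
split=> [[Kreg Kmin]|[Kreg Kmin]]; split.
- move=> a Ka; have : Reg (ideal_type K) (exist _ a (mem_set Ka)).
    by rewrite -Kreg.
  move=> [_ [[x _ <-]]]; rewrite -Order.le_val !valM /= => ax.
  by exists (val x) => //; exact/set_mem/(valP x).
- move=> a b Ka Kb.
  have [x] := Kmin (exist _ a (mem_set Ka)) (exist _ b (mem_set Kb)).
  rewrite -Order.le_val valM /= => ax.
  by exists (val x) => //; exact/set_mem/(valP x).
- apply/esym/seteqP; split=> // a _.
  have [x Kx ax] := Kreg _ (set_mem (valP a)).
  exists (a * exist _ x (mem_set Kx) * a); split.
    by exists (exist _ x (mem_set Kx)).
  by rewrite -Order.le_val !valM.
- move=> a b.
  have [x Kx ax] := Kmin _ _ (set_mem (valP a)) (set_mem (valP b)).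
  by exists (exist _ x (mem_set Kx)); rewrite -Order.le_val valM.
Qed.

(** From b <= (bz)b, left multiplication by bz can be iterated until the power
    of bz enters K. *)
Lemma nil_extension_Reg_sub : nil_extension K -> Reg S `<=` ideal_set K.
Proof.
move=> nilK b /mem_set/RegP[z bz]; have [m m0 /set_mem Km] := nilK (b * z).
exact: ideal_le (le_spow_mull _ _ _ m0 bz) (ideal_mulgr _ _ _ Km).
Qed.

Hypothesis lglK : left_group_like (ideal_type K).

(** Both conditions on S follow from this: the first with a power of a and its
    right multiple by b, the second once a and b are known to be in K. *)
Lemma left_group_like_le_sandwich a b : ideal_set K a -> ideal_set K b ->
  exists x, a <= a * x * b.
Proof.
move=> Ka Kb; have [Kreg Kmin] := left_group_like_idealP.1 lglK.
have [x _ ax] := Kreg a Ka; have [y _ ay] := Kmin a b Ka Kb.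
exists (x * y); apply: (le_trans ax).
by have := le_mulgl (a * x) _ _ ay; rewrite !mulgA.
Qed.

End NilExtension.

Section RegularIdeal.

Hypothesis pow_sandwich : forall a b, exists2 n : nat, (0 < n)%N &
  spow a n \in down (sandwich (spow a n) (spow a n * b)).
Hypothesis Reg_swap : forall a b, b \in Reg S -> a <= b * a ->
  exists x, a <= a * x * b.

Lemma pow_sandwichE a b : exists2 n : nat, (0 < n)%N &
  exists s, spow a n <= spow a n * s * (spow a n * b).
Proof.
have [n n0 /set_mem[_ [[s _ <-] ans]]] := pow_sandwich a b.
by exists n => //; exists s.
Qed.

(** Sandwiching a power p of a with right factor a yields p <= p t p a^k for
    every k; taking k to be the exponent of p makes the right end p itself. *)
Lemma regular_power a : exists2 n : nat, (0 < n)%N & spow a n \in Reg S.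
Proof.
have [n n0 [s ps]] := pow_sandwichE a a; exists n => //.
have [t pt] := le_mul_spow _ _ _ _ n0 ps.
by apply/RegP; exists (t * spow a n); move: pt; rewrite !mulgA.
Qed.

(** The element xa attached to a regular a is below its own square, hence below
    the power of it that is bounded by a left multiple of b. *)
Lemma Reg_le_mull a b : a \in Reg S -> exists y, a <= y * b.
Proof.
move=> /RegP[x ax]; have [n n0 [s es]] := pow_sandwichE (x * a) b.
have ee : x * a <= x * a * (x * a).
  by have := le_mulgl x _ _ ax; rewrite !mulgA.
have := le_trans (le_spow_idem _ _ n0 ee) es.
set e := spow _ _ => xa; exists (a * (e * s * e)).
apply: (le_trans ax).
by have := le_mulgl a _ _ xa; rewrite !mulgA.
Qed.

(** Replacing z by a regular power b brings the hypothesis into the scope of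
    the exchange condition, giving a <= axb; since b, being regular, lies
    below a left multiple of a, this closes up to a <= a(xy)a. *)
Lemma regular_of_le_mull a z : a <= z * a -> a \in Reg S.
Proof.
move=> za; have [n n0 zn] := regular_power z.
have [x ax] := Reg_swap _ _ zn (le_spow_mull _ _ _ n0 za).
have [y bya] := Reg_le_mull _ a zn.
apply/RegP; exists (x * y); apply: (le_trans ax).
by have := le_mulgl (a * x) _ _ bya; rewrite !mulgA.
Qed.

Lemma Reg_nonempty : Reg S !=set0.
Proof.
have [a _] := @osg_nonempty d S; have [n _ /set_mem an] := regular_power a.
by exists (spow a n).
Qed.

Lemma Reg_mull : [set s * i | s in [set: S] & i in Reg S] `<=` Reg S.
Proof.
move=> _ [s _ [a /mem_set Ra <-]].
have [y ay] := Reg_le_mull _ (s * a) Ra.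
apply/set_mem/(regular_of_le_mull _ (s * y)).
by have := le_mulgl s _ _ ay; rewrite !mulgA.
Qed.

Lemma Reg_mulr : [set i * s | i in Reg S & s in [set: S]] `<=` Reg S.
Proof.
move=> _ [a /mem_set Ra [c _ <-]]; have [y ay] := Reg_le_mull _ a Ra.
apply/set_mem/(regular_of_le_mull _ y).
by have := le_mulgr c _ _ ay; rewrite !mulgA.
Qed.

Lemma Reg_down : down (Reg S) = Reg S.
Proof.
apply/seteqP; split=> [a [b [/mem_set Rb ab]]|a Ra]; last by exists a.
have [y bya] := Reg_le_mull _ a Rb.
apply/set_mem/(regular_of_le_mull _ y).
exact: le_trans ab bya.
Qed.

Definition Reg_ideal : ideal S :=
  Ideal Reg_nonempty Reg_mull Reg_mulr Reg_down.

(** Inner multipliers supplied by S are absorbed into the ideal by inserting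
    one more use of regularity. *)
Lemma Reg_ideal_left_group_like : left_group_like (ideal_type Reg_ideal).
Proof.
apply/left_group_like_idealP; split=> [a Ra|a b Ra Rb].
  have [x ax] := (RegP a).1 (mem_set Ra); exists (x * a * x).
    exact/(ideal_mulgr Reg_ideal)/(ideal_mulgl Reg_ideal).
  apply: (le_trans ax).
  by have := le_mulgr (x * a) _ _ ax; rewrite !mulgA.
have [y ay] := Reg_le_mull _ b (mem_set Ra).
have [x bx] := (RegP b).1 (mem_set Rb); exists (y * b * x).
  exact/(ideal_mulgr Reg_ideal)/(ideal_mulgl Reg_ideal).
apply: (le_trans ay).
by have := le_mulgl y _ _ bx; rewrite !mulgA.
Qed.

End RegularIdeal.

End OrderedSemigroupTheory.

Theorem theorem3p2 (d : Order.disp_t) (S : orderedSemigroupType d) :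
  nil_extension_of_left_group_like S <->
  ((forall a b : S, exists2 n : nat, (0 < n)%N &
      spow a n \in down (sandwich (spow a n) (spow a n * b))) /\
   (forall a b : S, b \in Reg S -> a <= b * a -> exists x : S, a <= a * x * b)).
Proof.
split=> [[K [nilK lglK]]|[pow_sandwich Reg_swap]]; last first.
  exists (Reg_ideal pow_sandwich Reg_swap).
  split; last exact: Reg_ideal_left_group_like.
  exact: regular_power.
split=> [a b|a b /set_mem Rb aba].
  have [m m0 /set_mem Km] := nilK a; exists m => //; apply/mem_set.
  have [x ax] := left_group_like_le_sandwich _ lglK _ _ Km
    (ideal_mulgr _ _ b Km).
  by exists (spow a m * x * (spow a m * b)); split=> //; exists x.
have Kb : ideal_set K b by exact: nil_extension_Reg_sub nilK _ Rb.
have Ka := ideal_le _ _ _ aba (ideal_mulgr _ _ a Kb).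
exact: left_group_like_le_sandwich lglK _ _ Ka Kb.
Qed.
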